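(* Let $G$ be a binary quasigroup of order $n$, let $k\ge1$, and for $d\ge1$ let $M(G^{[d]})$ be the $(d+1)$-dimensional MDS code of the $d$-iterated quasigroup $G$. Then, as $d\to\infty$ through the values of $d$ for which $\mathrm{Per}_k M(G^{[d]})>0$, the ratio of the number of connected indivisible $k$-plexes in $M(G^{[d]})$ to the number of $k$-multiplexes in $M(G^{[d]})$ tends to $1$. Equivalently, there is a constant $c(G,k)>0$ such that the ratio of the number of connected indivisible $k$-plexes in $M(G^{[d]})$ to $\left(\frac{(kn)!}{k!^n}\right)^{d-1}$ tends to $c(G,k)$ as $d\to\infty$, the limit being taken over all $d$ for which $\mathrm{Per}_k M(G^{[d]})>0$.
   Context: A binary quasigroup of order $n$ is a binary operation $*$ on $\{1,\ldots,n\}$ such that for all $a,b$ each of $a*x=b$ and $x*a=b$ has a unique solution $x$. $M(G^{[d]})$ is the $(d+1)$-dimensional $(0,1)$-array of order $n$ with indices $(x_0,\ldots,x_d)\in\{1,\ldots,n\}^{d+1}$ whose entry is $1$ iff $(\cdots((x_0*x_1)*x_2)*\cdots)*x_d=1$. A hyperplane is a set of indices with one coordinate fixed. A $k$-multiplex in $M(G^{[d]})$ is a multiset $K$ of $kn$ indices, all in the support of $M(G^{[d]})$, such that every hyperplane contains exactly $k$ elements of $K$ counted with multiplicity; a $k$-plex is a $k$-multiplex with no repeated elements; $\mathrm{Per}_k M(G^{[d]})$ is the number of $k$-multiplexes in $M(G^{[d]})$. A $k$-multiplex $K$ is divisible if it is the multiset union of a $k_1$-multiplex and a $k_2$-multiplex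 with $k_1,k_2\ge1$, $k_1+k_2=k$, and indivisible otherwise. $K$ is disconnected if there are positive $n_1,n_2$ with $n_1+n_2=n$, for each coordinate $j$ a partition $\{1,\ldots,n\}=S_j^1\sqcup S_j^2$ with $|S_j^i|=n_i$, and $K$ is the multiset union of $K_1,K_2$ where $K_i$ is a multiset of $kn_i$ indices in $\prod_j S_j^i$ in which each value of $S_j^i$ appears exactly $k$ times in coordinate $j$; otherwise $K$ is connected.
   Formalization: The cases k = 1 with n ≥ 2 and n = 1 with k ≥ 2 are excluded: in the first every 1-plex is disconnected, in the second the only k-multiplex is one index repeated k times and is not a k-plex, so the ratio is 0 and the claim fails. *)

(* Defs.v *)
From mathcomp Require Import all_boot all_order all_algebra.
From mathcomp Require Import finmap multiset.
From mathcomp Require Import all_classical all_reals all_analysis.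

Set Implicit Arguments.
Unset Strict Implicit.
Unset Printing Implicit Defensive.

Local Open Scope nat_scope.

(* The ground set {1, ..., n} is 'I_n; its element 1 is the ordinal of value 0. *)

Definition quasigroup (n : nat) (op : 'I_n -> 'I_n -> 'I_n) : Prop :=
  forall a b : 'I_n,
    (exists! x : 'I_n, op a x = b) /\ (exists! x : 'I_n, op x a = b).

(* The coordinate x_j of an index x = (x_0, ..., x_d) is tnth x j. *)
Definition array_index (n d : nat) := (d.+1).-tuple 'I_n.

Definition iterated (n : nat) (op : 'I_n -> 'I_n -> 'I_n) (d : nat)
  (x : array_index n d) : 'I_n := foldl op (thead x) (behead x).

(* A (0,1)-array is represented by a boolean function on indices. *)
Definition mds_code (n : nat) (op : 'I_n -> 'I_n -> 'I_n) (d : nat)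
  (x : array_index n d) : bool := (iterated op x : nat) == 0.

Definition hyperplane (n d : nat) (j : 'I_d.+1) (a : 'I_n) : {set array_index n d} :=
  [set x | tnth x j == a]%SET.

(* A multiset coerces to the sequence of its elements, repeated according to
   their multiplicities, so size and count take multiplicities into account. *)
Definition is_multiplex (n : nat) (op : 'I_n -> 'I_n -> 'I_n) (d k : nat)
  (K : {mset array_index n d}%mset) : Prop :=
  [/\ size K = k * n,
      forall x, x \in K -> mds_code op x
    & forall (j : 'I_d.+1) (a : 'I_n),
        count [pred x | x \in hyperplane j a] K = k].

Definition is_plex (n : nat) (op : 'I_n -> 'I_n -> 'I_n) (d k : nat)
  (K : {mset array_index n d}%mset) : Prop :=
  is_multiplex op k K /\ forall x, x \in K -> K x = 1.

Definition divisible (n : nat) (op : 'I_n -> 'I_n -> 'I_n) (d k : nat)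
  (K : {mset array_index n d}%mset) : Prop :=
  exists k1 k2 : nat, [/\ 0 < k1, 0 < k2, k1 + k2 = k
    & exists K1 K2 : {mset array_index n d}%mset,
        [/\ is_multiplex op k1 K1, is_multiplex op k2 K2
          & K = (K1 `+` K2)%mset]].

Definition indivisible (n : nat) (op : 'I_n -> 'I_n -> 'I_n) (d k : nat)
  (K : {mset array_index n d}%mset) : Prop := ~ divisible op k K.

Definition balanced_in_box (n d k m : nat) (S : 'I_d.+1 -> {set 'I_n})
  (K : {mset array_index n d}%mset) : Prop :=
  [/\ size K = k * m,
      forall x, x \in K -> forall j, tnth x j \in S j
    & forall (j : 'I_d.+1) (a : 'I_n), a \in S j ->
        count [pred x : array_index n d | tnth x j == a] K = k].

Definition disconnected (n d k : nat) (K : {mset array_index n d}%mset) : Prop :=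
  exists n1 n2 : nat, [/\ 0 < n1, 0 < n2, n1 + n2 = n
    & exists S1 S2 : 'I_d.+1 -> {set 'I_n},
        (forall j, [/\ (S1 j :|: S2 j = [set: 'I_n])%SET,
                       [disjoint S1 j & S2 j],
                       #|S1 j| = n1 & #|S2 j| = n2]) /\
        exists K1 K2 : {mset array_index n d}%mset,
          [/\ balanced_in_box k n1 S1 K1, balanced_in_box k n2 S2 K2
            & K = (K1 `+` K2)%mset]].

Definition connected_multiplex (n d k : nat) (K : {mset array_index n d}%mset) :
  Prop := ~ disconnected k K.

Definition multiplexes (n : nat) (op : 'I_n -> 'I_n -> 'I_n) (k d : nat) :
  set {mset array_index n d}%mset := [set K | is_multiplex op k K]%classic.

Definition conn_indiv_plexes (n : nat) (op : 'I_n -> 'I_n -> 'I_n) (k d : nat) :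
  set {mset array_index n d}%mset :=
  [set K | [/\ is_plex op k K, connected_multiplex k K
             & indivisible op k K]]%classic.

(* fset_set is the empty set on infinite arguments; the two lemmas below show
   that the cardinals taken here are genuine. *)
Lemma finite_multiplexes (n : nat) (op : 'I_n -> 'I_n -> 'I_n) (k d : nat) :
  finite_set (multiplexes op k (d := d)).
Proof.
apply: (@sub_finite_set _ _
  ((fun t : (k * n).-tuple (array_index n d) => seq_mset t) @` setT)%classic).
  move=> K [sK _ _] /=; have sK' : size K == k * n by rewrite sK.
  by exists (Tuple sK') => //=; rewrite seq_mset_id.
by apply: finite_image; apply: finite_finset.
Qed.

Lemma finite_conn_indiv_plexes (n : nat) (op : 'I_n -> 'I_n -> 'I_n)
  (k d : nat) : finite_set (conn_indiv_plexes op k (d := d)).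
Proof.
by apply: sub_finite_set (@finite_multiplexes n op k d) => K [[]].
Qed.

Definition Per (n : nat) (op : 'I_n -> 'I_n -> 'I_n) (k d : nat) : nat :=
  #|` fset_set (multiplexes op k (d := d))|%fset.

Definition num_conn_indiv_plexes (n : nat) (op : 'I_n -> 'I_n -> 'I_n)
  (k d : nat) : nat := #|` fset_set (conn_indiv_plexes op k (d := d))|%fset.

(* Main.v *)
Require Import Defs.
From mathcomp Require Import all_boot all_order all_algebra perm.
From mathcomp Require Import finmap multiset.
From mathcomp Require Import all_classical all_reals all_analysis.
From mathcomp Require Import ring lra zify.
Import Order.TTheory GRing.Theory Num.Theory.
Import numFieldNormedType.Exports.
Local Open Scope classical_set_scope.
Local Open Scope ring_scope.

Set Implicit Arguments.
Unset Strict Implicit.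
Unset Printing Implicit Defensive.

(* Order the [k * n] elements of a multiplex: it becomes a sequence of [d.+1]
   columns, each containing every symbol [k] times, such that the entrywise
   iterated product of the columns is constant, equal to 1.  These are the walks
   of length [d.+1] from a constant column to itself for the chain [x -> x * c],
   [c] balanced, on all columns.

   Each step of this chain is a permutation, so the number of states from which
   the target is reached in exactly [m] steps is nondecreasing in [m], hence
   eventually constant; from then on averaging over the steps contracts the
   walk densities on these states, which converge to the inverse of that number.
   No period has to be mentioned, which is why the limit is the same along all
   [d] with [Per op k d > 0].

   If all balanced columns occur in the sequence, the multiplex is a connected
   indivisible plex, and missing one of the [M] balanced columns leaves at most
   [(M - 1) ^ d.+1] sequences out of [M ^ d.+1]. *)

(** * Walks to a fixed target and the states they start from *)

Section Walks.
Local Open Scope nat_scope.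
Variables (X I : finType) (B : {set I}) (f : X -> I -> X).

(** Counts the words of length [m] over [B] that lead from [x] to [o]; the recursion splits off the
    first letter. *)
Fixpoint walks (o : X) (m : nat) (x : X) : nat :=
  if m is m'.+1 then \sum_(i in B) walks o m' (f x i) else x == o.

Definition sources (o : X) (m : nat) : {set X} := [set x | 0 < walks o m x]%SET.

Lemma sources0 o : sources o 0 = [set o]%SET.
Proof. by apply/setP => x; rewrite !inE /= lt0b. Qed.

Lemma sourcesSP o m x :
  reflect (exists2 i, i \in B & f x i \in sources o m) (x \in sources o m.+1).
Proof.
rewrite inE /= lt0n sum_nat_eq0 negb_forall; apply: (iffP existsP) => -[i].
  by rewrite negb_imply -lt0n => /andP[iB w]; exists i; rewrite ?inE.
by move=> iB; rewrite inE => w; exists i; rewrite negb_imply iB -lt0n.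
Qed.

Lemma sources_trans o z m l x :
  z \in sources o m -> x \in sources z l -> x \in sources o (l + m).
Proof.
move=> zo; elim: l x => [|l IH] x; first by rewrite sources0 inE => /eqP->.
by case/sourcesSP => i iB /IH ?; apply/sourcesSP; exists i.
Qed.

Hypothesis f_inj : forall i, i \in B -> injective (f^~ i).

(** Each letter permutes a finite set, so the first step is undone by repeating the same letter; the
    way back may have another length. *)
Lemma sources_sym o m x : x \in sources o m -> exists j, o \in sources x j.
Proof.
elim: m x => [|m IH] x.
  by rewrite sources0 inE => /eqP->; exists 0; rewrite sources0 inE.
case/sourcesSP => i iB /IH[j oj].
exists (j + (order (f^~ i) x).-1).
apply: sources_trans oj.
have: iter (order (f^~ i) x).-1 (f^~ i) (f x i) = x.
  by rewrite -iterSr prednK ?order_gt0 // iter_order //; apply: f_inj.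
elim: (order _ _).-1 (f x i) => [|l IHl] y; first by move=> /= ->; rewrite sources0 inE.
by rewrite iterSr => /IHl ?; apply/sourcesSP; exists i.
Qed.

(** Every letter permutes the states, so each word leads to [o] from exactly one state. *)
Lemma walks_sum o m : \sum_x walks o m x = #|B| ^ m.
Proof.
elim: m => [|m IH] /=.
  by rewrite (bigD1 o) //= eqxx big1 // => x /negbTE->.
rewrite exchange_big /= expnS -sum_nat_const; apply: eq_bigr => i iB.
by rewrite -IH [RHS](reindex_inj (f_inj iB)).
Qed.

Lemma sub_sourcesS o m i :
  i \in B -> f^~ i @^-1: sources o m \subset sources o m.+1.
Proof.
by move=> iB; apply/fintype.subsetP => x; rewrite inE => ?; apply/sourcesSP; exists i.
Qed.

Lemma card_preim_sources o m i :
  i \in B -> #|f^~ i @^-1: sources o m| = #|sources o m|.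
Proof. by move=> iB; apply/on_card_preimset/onW_bij/injF_bij/f_inj. Qed.

Hypothesis B_gt0 : 0 < #|B|.

(** The preimage of [sources o m] under one letter has the same size and lies in
    [sources o m.+1]. *)
Lemma leq_card_sources o m l : m <= l -> #|sources o m| <= #|sources o l|.
Proof.
have /card_gt0P[i iB] := B_gt0.
move=> /subnK<-; elim: (l - m) => [//|p IH]; rewrite addSn.
by apply: leq_trans IH _; rewrite -(card_preim_sources o _ iB) subset_leq_card ?sub_sourcesS.
Qed.

Lemma card_sources_gt0 o m : 0 < #|sources o m|.
Proof.
by apply: leq_trans (leq_card_sources o (leq0n m)); rewrite sources0 cards1.
Qed.

Lemma card_sources_stable o :
  exists m0, forall m, m0 <= m -> #|sources o m| = #|sources o m0|.
Proof.
have exP : exists v, `[< exists m, #|sources o m| = v >].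
  by exists #|sources o 0|; apply/asboolP; exists 0.
have ubP v : `[< exists m, #|sources o m| = v >] -> v <= #|X|.
  by move=> /asboolP[m <-]; exact: max_card.
case: (ex_maxnP exP ubP) => v /asboolP[m0 <-] vmax; exists m0 => m mm.
apply/anti_leq; rewrite (leq_card_sources o mm) andbT.
by apply: vmax; apply/asboolP; exists m.
Qed.

(** When the sizes agree, that preimage is all of [sources o m.+1], whichever letter is taken. *)
Lemma sources_stable_step o m i x : #|sources o m.+1| = #|sources o m| ->
  i \in B -> x \in sources o m.+1 -> f x i \in sources o m.
Proof.
move=> e iB; have /eqP<- : f^~ i @^-1: sources o m == sources o m.+1.
  by rewrite eqEcard (sub_sourcesS _ _ iB) e (card_preim_sources _ _ iB) /=.
by rewrite inE.
Qed.

(* [o] can be left towards any [z] of [sources o m], so [sources z l] eventually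
   has at least as many points as [sources o m0], hence fills [sources o (l + m)]. *)
Lemma sources_uniform o m0 :
    (forall m, m0 <= m -> #|sources o m| = #|sources o m0|) ->
  exists L, forall m z, m0 <= m -> z \in sources o m ->
    sources z L = sources o (L + m).
Proof.
move=> st.
have /fin_all_exists[j jP] : forall z, exists j,
    (exists m, z \in sources o m) -> o \in sources z j.
  move=> z; have [[m zm]|nz] := pselect (exists m, z \in sources o m).
    by have [j oj] := sources_sym zm; exists j.
  by exists 0.
exists (m0 + \max_z j z) => m z mm zm; apply/eqP; rewrite eqEcard; apply/andP; split.
  by apply/fintype.subsetP => x; apply: sources_trans.
rewrite st; last by rewrite -addnA leq_addr.
apply: (@leq_trans #|sources z (m0 + j z)|); last first.
  by apply: leq_card_sources; rewrite leq_add2l leq_bigmax.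
apply/subset_leq_card/fintype.subsetP => x.
by apply: sources_trans; apply: jP; exists m.
Qed.

(** * Averages along the steps of a walk *)

Section Averages.
Variable R : realFieldType.
Local Open Scope ring_scope.

Let M : R := #|B|%:R.
Let M_gt0 : 0 < M. Proof. by rewrite ltr0n. Qed.
Let M_ge1 : 1 <= M. Proof. by rewrite ler1n. Qed.

Definition averaging (g : nat -> X -> R) :=
  forall m x, g m.+1 x = M^-1 * \sum_(i in B) g m (f x i).

(** The probability that a uniformly random word of length [m] leads from [x] to [o]. *)
Definition walk_density o m x : R := (walks o m x)%:R / M ^+ m.

Lemma averaging_walk_density o : averaging (walk_density o).
Proof.
move=> m x; rewrite /walk_density /= natr_sum mulr_suml exprS mulr_sumr.
by apply: eq_bigr => i _; rewrite invfM mulrCA.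
Qed.

Lemma averagingN g : averaging g -> averaging (fun m x => - g m x).
Proof. by move=> ag m x; rewrite ag sumrN mulrN. Qed.

Lemma averaging_ge g lo m x :
    averaging g -> (forall i, i \in B -> lo <= g m (f x i)) ->
  lo <= g m.+1 x.
Proof.
move=> -> glo; rewrite mulrC ler_pdivlMr //.
rewrite mulr_natr -sumr_const; exact: ler_sum.
Qed.

Variables (o : X) (m0 : nat).
Hypothesis stable : forall m, (m0 <= m)%N -> #|sources o m| = #|sources o m0|.

Let stableS m i x : (m0 <= m)%N -> i \in B -> x \in sources o m.+1 ->
  f x i \in sources o m.
Proof.
by move=> mm; apply: sources_stable_step; rewrite !stable // leqW.
Qed.

(** From [m0] on every letter maps [sources o m.+1] into [sources o m], so the means involve only
    values already bounded below. *)
Lemma averaging_ge_sources g lo m l : averaging g -> (m0 <= m)%N ->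
    {in sources o m, forall x, lo <= g m x} ->
  {in sources o (l + m), forall x, lo <= g (l + m)%N x}.
Proof.
move=> ag mm glo; elim: l => [//|l IH] x; rewrite addSn => xs.
apply: averaging_ge => // i iB; apply: IH; apply: stableS => //.
by rewrite (leq_trans mm) ?leq_addl.
Qed.

(** Along a walk from [x] to [z], each mean keeps at least the fraction [M^-1] of the excess over
    [lo], the other terms being nonnegative. *)
Lemma averaging_gain g lo m l z : averaging g -> (m0 <= m)%N ->
    {in sources o m, forall x, lo <= g m x} -> z \in sources o m ->
  {in sources z l, forall x, (g m z - lo) / M ^+ l <= g (l + m)%N x - lo}.
Proof.
move=> ag mm glo zm; elim: l => [|l IH] x.
  by rewrite sources0 inE => /eqP->; rewrite expr0 divr1.
move=> xz; have xs := sources_trans zm xz.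
case/sourcesSP: xz => i iB /IH; set t := _ / _ => ht.
have ml : (m0 <= l + m)%N by rewrite (leq_trans mm) ?leq_addl.
have gl i' : i' \in B -> 0 <= g (l + m)%N (f x i') - lo.
  by move=> i'B; rewrite subr_ge0 (averaging_ge_sources ag mm glo) // stableS.
have -> : g (l.+1 + m)%N x - lo = M^-1 * \sum_(i' in B) (g (l + m)%N (f x i') - lo).
  rewrite addSn ag sumrB sumr_const -[lo *+ _]mulr_natl mulrBr mulKf //.
  by rewrite gt_eqF.
rewrite exprS invfM mulrCA ler_pM2l ?invr_gt0 //.
rewrite (bigD1 i) //= -[leLHS]addr0 lerD //.
by apply: sumr_ge0 => i' /andP[i'B _]; exact: gl.
Qed.

End Averages.
End Walks.

(** * Convergence of the walk densities *)

Section WalkLimit.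
Variables (R : realType) (X I : finType) (B : {set I}) (f : X -> I -> X).
Hypothesis f_inj : forall i, i \in B -> injective (f^~ i).
Hypothesis B_gt0 : (0 < #|B|)%N.
Variables (o : X) (m0 : nat).
Hypothesis stable :
  forall m, (m0 <= m)%N -> #|sources B f o m| = #|sources B f o m0|.

Let M : R := #|B|%:R.
Let M_ge1 : 1 <= M. Proof. by rewrite ler1n. Qed.
Let M_gt0 : 0 < M. Proof. exact: lt_le_trans M_ge1. Qed.
Let v := walk_density B f R o.
Let C := sources B f o.
Let between m lo hi := {in C m, forall x, lo <= v m x <= hi}.

Let betweenD l m lo hi :
  (m0 <= m)%N -> between m lo hi -> between (l + m) lo hi.
Proof.
move=> mm h x xs; have av : averaging B f v := averaging_walk_density B f R o.
rewrite (averaging_ge_sources f_inj B_gt0 stable av mm) //=.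
  (* The upper bound is a lower bound for the negated densities. *)
  rewrite -[leLHS]opprK lerNl.
  apply: (averaging_ge_sources f_inj B_gt0 stable (averagingN av) mm) => // y ys.
  by rewrite lerN2; have /andP[] := h y ys.
by move=> y ys; have /andP[] := h y ys.
Qed.

(** The value at any [z] of [C m] lies in one half of the interval. All points of [C (L + m)] reach
    [z] in exactly [L] steps, so the opposite end moves in by [(M ^+ L)^-1] times half the
    length. *)
Let between_contract L m lo hi : (m0 <= m)%N ->
    {in C m, forall z, sources B f z L = C (L + m)%N} ->
    between m lo hi ->
  exists lo' hi', between (L + m) lo' hi' /\
    hi' - lo' = (1 - (M ^+ L)^-1 / 2) * (hi - lo).
Proof.
move=> mm unif h; have av : averaging B f v := averaging_walk_density B f R o.
have hL := betweenD (l := L) mm h.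
have M_L : 0 < (M ^+ L)^-1 by rewrite invr_gt0 exprn_gt0.
have /card_gt0P[z zm] : (0 < #|C m|)%N by exact: card_sources_gt0.
set e := _^-1 in M_L *.
have [vz|vz] := lerP ((lo + hi) / 2) (v m z).
  exists (lo + e / 2 * (hi - lo)), hi; split; last by ring.
  move=> x xs; have /andP[_ ->] := hL x xs; rewrite andbT -lerBrDl.
  move: xs; rewrite -(unif z zm) => xs.
  have := averaging_gain f_inj B_gt0 stable av mm _ zm xs.
  move=> /(_ lo) gain; apply: le_trans (gain _); last by move=> y /h /andP[].
  have -> : e / 2 * (hi - lo) = (hi - lo) / 2 * e by ring.
  by rewrite ler_wpM2r ?(ltW M_L) //; lra.
exists lo, (hi - e / 2 * (hi - lo)); split; last by ring.
move=> x xs; have /andP[-> _] := hL x xs; rewrite /= lerBrDr -lerBrDl.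
move: xs; rewrite -(unif z zm) => xs.
have := averaging_gain f_inj B_gt0 stable (averagingN av) mm _ zm xs.
move=> /(_ (- hi)) gain; rewrite -lerN2.
have {gain} : (- v m z - - hi) * e <= - v (L + m)%N x - - hi.
  by apply: gain => y /h /andP[_]; rewrite lerN2.
have : e / 2 * (hi - lo) <= (- v m z - - hi) * e.
  have -> : e / 2 * (hi - lo) = (hi - lo) / 2 * e by ring.
  by rewrite ler_wpM2r ?(ltW M_L) //; lra.
lra.
Qed.

(** The densities on [C m] sum to 1, so their mean is the inverse of [#|C m|], which is constant
    from [m0] on. *)
Let between_card m lo hi : (m0 <= m)%N -> between m lo hi ->
  lo <= #|C m0|%:R^-1 <= hi.
Proof.
move=> mm h; have C_gt0 : 0 < #|C m0|%:R :> R.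
  by rewrite ltr0n card_sources_gt0.
have tot : \sum_(x in C m) v m x = 1.
  rewrite /v /walk_density -mulr_suml -natr_sum.
  have -> : (\sum_(x in C m) walks B f o m x)%N = (#|B| ^ m)%N.
    rewrite -(walks_sum f_inj o m) [RHS](bigID [in C m]) /= [X in (_ + X)%N]big1 ?addn0 //.
    by move=> x; rewrite inE -leqNgt leqn0 => /eqP.
  by rewrite natrX divff // expf_neq0 // gt_eqF.
rewrite -div1r ler_pdivlMr // ler_pdivrMr //.
rewrite !mulr_natr -!(stable mm) -!sumr_const -tot.
by apply/andP; split; apply: ler_sum => x /h /andP[].
Qed.

Lemma walk_density_cvg : exists2 s : R, 0 < s & forall e, 0 < e ->
  exists N, forall m x, (N <= m)%N -> x \in C m -> `|v m x - s| < e.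
Proof.
exists #|C m0|%:R^-1; first by rewrite invr_gt0 ltr0n card_sources_gt0.
move=> e e0; have [L unif] := sources_uniform f_inj B_gt0 stable.
set q : R := 1 - (M ^+ L)^-1 / 2.
have M_L : 0 < (M ^+ L)^-1 <= 1.
  by rewrite invr_gt0 exprn_gt0 //= invf_le1 ?exprn_gt0 // exprn_ege1.
have q_lt1 : `|q| < 1 by rewrite ger0_norm /q; lra.
(* Start from the interval from 0 to 1 and contract it [t] times. *)
have step t : exists lo hi, between (t * L + m0) lo hi /\ hi - lo = q ^+ t.
  elim: t => [|t [lo [hi [h ht]]]].
    exists 0, 1; split; last by rewrite subr0.
    rewrite mul0n add0n => x _; rewrite divr_ge0 ?ler0n ?exprn_ge0 ?(ltW M_gt0) //=.
    rewrite ler_pdivrMr ?exprn_gt0 // mul1r -natrX ler_nat -(walks_sum f_inj o m0).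
    by rewrite (bigD1 x) //= leq_addr.
  have tm : (m0 <= t * L + m0)%N by exact: leq_addl.
  have [lo' [hi' [h' ht']]] := between_contract tm (fun z => unif _ z tm) h.
  exists lo', hi'; split; first by rewrite mulSn -addnA.
  by rewrite ht' ht exprS.
have /cvgrPdist_lt/(_ e e0)[t _ /(_ t (leqnn t))] := cvg_expr q_lt1.
rewrite sub0r normrN => qt.
have [lo [hi [h hq]]] := step t.
exists (t * L + m0)%N => m x tm xm.
have mm : (m0 <= t * L + m0)%N by exact: leq_addl.
have := between_card mm h.
have := betweenD (l := m - (t * L + m0)) mm h; rewrite subnK // => /(_ x xm).
move: qt; rewrite -hq ltr_norml => /andP[_ qt] /andP[? ?] /andP[? ?].
by rewrite ltr_norml; apply/andP; split; lra.
Qed.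

End WalkLimit.

(** * Counting words *)

Section TupleCounting.
Local Open Scope nat_scope.
Variable I : finType.

Lemma card_cons_tuple m (P : pred (m.+1.-tuple I)) :
  #|[set s | P s]%SET| = \sum_i #|[set t : m.-tuple I | P [tuple of i :: t]]%SET|.
Proof.
transitivity (\sum_(i : I) \sum_(t : m.-tuple I | P [tuple of i :: t]) 1); last first.
  by apply: eq_bigr => i _; rewrite sum1_card cardsE.
rewrite pair_big_dep /= cardsE -sum1_card.
rewrite (reindex (fun p : I * m.-tuple I => [tuple of p.1 :: p.2])) //.
exists (fun s => (thead s, [tuple of behead s])) => [[i t] _|s _] /=.
  by congr pair; apply: val_inj.
by rewrite [RHS]tuple_eta; apply: val_inj.
Qed.

Lemma card_walks (X : finType) (B : {set I}) (f : X -> I -> X) o m x :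
  #|[set t : m.-tuple I | all [in B] t && (foldl f x t == o)]%SET|
    = walks B f o m x.
Proof.
elim: m x => [|m IH] x /=.
  have [xo|xo] := eqVneq x o.
    by rewrite (_ : finset _ = [set [tuple]]%SET) ?cards1 //; apply/setP => t;
       rewrite !inE tuple0 /= xo !eqxx.
  by rewrite (_ : finset _ = finset.set0) ?cards0 //; apply/setP => t;
     rewrite !inE tuple0 /= (negbTE xo).
rewrite (card_cons_tuple (fun t => all [in B] t && (foldl f x t == o))) /=.
rewrite [RHS]big_mkcond; apply: eq_bigr => i _; rewrite /= -IH.
case: ifP => iB //=; apply/eqP; rewrite cards_eq0; apply/eqP/setP => t.
by rewrite !inE.
Qed.

Lemma card_all_tuple (A : {set I}) m :
  #|[set t : m.-tuple I | all [in A] t]%SET| = #|A| ^ m.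
Proof.
(* On a one-point state space every word over [A] is a walk. *)
transitivity (walks A (fun _ _ => tt) tt m tt).
  by rewrite -card_walks; apply: eq_card => t; rewrite !inE andbT.
by elim: m => //= m ->; rewrite sum_nat_const expnS.
Qed.

Lemma count_tuple T r (P : pred T) (c : r.-tuple T) :
  count P c = #|[set i | P (tnth c i)]%SET|.
Proof. by rewrite -sum1_count big_tuple sum1_card cardsE. Qed.

(* Double counting of the first entry: the number of words with contents [w]
   satisfies the recursion of the multinomial coefficients. *)
Lemma card_tuple_contents r (w : I -> nat) : \sum_a w a = r ->
  #|[set c : r.-tuple I | [forall a, count_mem a c == w a]]%SET|
    * \prod_a (w a)`! = r`!.
Proof.
elim: r w => [|r IH] w wr.
  have w0 a : w a = 0.
    by apply/eqP; rewrite -leqn0 -wr (bigD1 a) //= leq_addr.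
  rewrite [\prod_a _]big1 => [|a _]; last by rewrite w0.
  rewrite (_ : finset _ = [set [tuple]]%SET) ?cards1 //; apply/setP => t.
  by rewrite !inE tuple0 eqxx; apply/forallP => a /=; rewrite w0.
rewrite (card_cons_tuple (fun c => [forall a, count_mem a c == w a])).
rewrite factS -[X in _ = X * _]wr !big_distrl /=; apply: eq_bigr => a _.
have [wa0|wa_gt0] := posnP (w a).
  rewrite wa0 mul0n; apply/eqP; rewrite muln_eq0 cards_eq0; apply/orP; left.
  apply/eqP/setP => t; rewrite !inE; apply/negbTE/forallPn; exists a.
  by rewrite /= eqxx wa0.
pose w' b := w b - (b == a).
have w'r : \sum_b w' b = r.
  apply: succn_inj; rewrite -wr (bigD1 a) //= [RHS](bigD1 a) //= /w' eqxx.
  rewrite -addSn subn1 prednK //; congr addn.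
  by apply: eq_bigr => b /negbTE->; rewrite subn0.
rewrite -(IH _ w'r) [X in _ * X](bigD1 a) //= [X in w a * (_ * X)](bigD1 a) //=.
rewrite {2}/w' eqxx subn1 -{1}(prednK wa_gt0) factS (prednK wa_gt0).
have -> : \prod_(b | b != a) (w' b)`! = \prod_(b | b != a) (w b)`!.
  by apply: eq_bigr => b /negbTE ba; rewrite /w' ba subn0.
rewrite (_ : finset _ =
  [set c : r.-tuple I | [forall b, count_mem b c == w' b]]%SET); first by rewrite -!mulnA mulnCA.
apply/setP => t; rewrite !inE; apply: eq_forallb => b /=.
rewrite /w' [b == a]eq_sym; have [<-|ab] := eqVneq a b; last by rewrite subn0.
by rewrite add1n subn1 -{1}(prednK wa_gt0) eqSS.
Qed.

End TupleCounting.

(** * Exchanging rows and columns *)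

Section Transpose.
Local Open Scope nat_scope.
Variable T : Type.

(** The rows are the elements of an ordered multiplex, and the columns collect their entries at one
    coordinate. *)
Definition transpose p q (u : p.-tuple (q.-tuple T)) : q.-tuple (p.-tuple T) :=
  [tuple [tuple tnth (tnth u i) j | i < p] | j < q].

Lemma tnth_transpose p q (u : p.-tuple (q.-tuple T)) i j :
  tnth (tnth (transpose u) j) i = tnth (tnth u i) j.
Proof. by rewrite !tnth_mktuple. Qed.

Lemma transposeK p q : cancel (@transpose p q) (@transpose q p).
Proof.
by move=> u; apply: eq_from_tnth => i; apply: eq_from_tnth => j; rewrite !tnth_transpose.
Qed.

End Transpose.

(** * Balanced columns *)

Section BalancedColumns.
Local Open Scope nat_scope.
Variables (n k : nat).

Definition balanced : {set (k * n).-tuple 'I_n} :=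
  [set c : (k * n).-tuple 'I_n | [forall a, count_mem a c == k]]%SET.

Lemma balancedP (c : (k * n).-tuple 'I_n) :
  reflect (forall a, count_mem a c = k) (c \in balanced).
Proof. by rewrite inE; apply: (iffP forallP) => h a; apply/eqP; rewrite h. Qed.

Lemma card_balanced : #|balanced| * k`! ^ n = (k * n)`!.
Proof.
rewrite -(@card_tuple_contents 'I_n (k * n) (fun _ => k)).
  by rewrite prod_nat_const card_ord.
by rewrite sum_nat_const card_ord mulnC.
Qed.

Lemma card_balanced_gt0 : 0 < #|balanced|.
Proof. by have := fact_gt0 (k * n); rewrite -card_balanced muln_gt0 => /andP[]. Qed.

Lemma balanced_tperm c v w : c \in balanced ->
  [tuple tnth c (tperm v w i) | i < k * n] \in balanced.
Proof.
move=> /balancedP cB; apply/balancedP => a; rewrite -[RHS](cB a).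
by apply/seq.permP/tuple_permP; exists (tperm v w).
Qed.

(** Some row [v] of a balanced column holds a symbol other than that of row [i]; exchange rows [v]
    and [i']. *)
Lemma balanced_separates i i' : 1 < n -> 0 < k -> i != i' ->
  exists2 c, c \in balanced & tnth c i != tnth c i'.
Proof.
move=> n1 k0 ii'; have /card_gt0P[c cB] := card_balanced_gt0.
have [b bi] : exists b, b != tnth c i.
  have: 0 < #|predC1 (tnth c i)| by rewrite cardC1 card_ord -subn1 subn_gt0.
  by case/card_gt0P => b; exists b.
have /tnthP[v bv] : b \in c by rewrite -has_pred1 has_count (balancedP _ cB).
exists [tuple tnth c (tperm v i' l) | l < k * n]; first exact: balanced_tperm.
rewrite !tnth_mktuple tpermR tpermD 1?eq_sym // -?bv //.
by apply: contraNneq bi => iv; rewrite bv iv.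
Qed.

(** As [k > 1], the symbol of row [i] occurs in a second row [v]; exchange rows [v] and [i']. *)
Lemma balanced_joins i i' : 1 < k ->
  exists2 c, c \in balanced & tnth c i = tnth c i'.
Proof.
move=> k1; have /card_gt0P[c cB] := card_balanced_gt0.
have [<-|ii'] := eqVneq i i'; first by exists c.
have := balancedP _ cB (tnth c i); rewrite count_tuple => ck.
have /card_gt1P[x [y [xc yc xy]]] : 1 < #|[set l | pred1 (tnth c i) (tnth c l)]%SET|.
  by rewrite ck.
have [v vi cv] : exists2 v, v != i & tnth c v = tnth c i.
  move: xc yc; rewrite !inE => /eqP cx /eqP cy.
  by have [xi|] := eqVneq x i; [exists y; rewrite // -xi eq_sym|exists x].
exists [tuple tnth c (tperm v i' l) | l < k * n]; first exact: balanced_tperm.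
by rewrite !tnth_mktuple tpermR tpermD // eq_sym.
Qed.

End BalancedColumns.

(** * The chain of entrywise products of columns *)

Section Columns.
Local Open Scope nat_scope.
Variables (n k : nat) (op : 'I_n -> 'I_n -> 'I_n).

Definition col_mul r (x c : r.-tuple 'I_n) : r.-tuple 'I_n :=
  [tuple op (tnth x i) (tnth c i) | i < r].

Lemma tnth_foldl_col_mul r (t : seq (r.-tuple 'I_n)) x i :
  tnth (foldl (@col_mul r) x t) i = foldl op (tnth x i) [seq tnth c i | c <- t].
Proof. by elim: t x => //= c t IH x; rewrite IH tnth_mktuple. Qed.

Hypothesis opP : quasigroup op.

Lemma quasigroup_injl a : injective (op a).
Proof.
move=> x y exy; have [[z [_ zu]] _] := opP a (op a x).
by rewrite -(zu x) // -(zu y).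
Qed.

Lemma quasigroup_injr a : injective (op^~ a).
Proof.
move=> x y exy; have [_ [z [_ zu]]] := opP a (op x a).
by rewrite -(zu x) // -(zu y).
Qed.

Lemma col_mul_inj r c : injective (fun x => @col_mul r x c).
Proof.
move=> x y /(congr1 (fun t => tnth t _)) e; apply: eq_from_tnth => i.
by apply: (@quasigroup_injr (tnth c i)); have := e i; rewrite !tnth_mktuple.
Qed.

(* Left translation by a constant column permutes the symbols, so the balanced
   columns are exactly the states reached in one step from a constant column. *)
Lemma balanced_walks (o : 'I_n) x m :
  \sum_(c in balanced n k) walks (balanced n k) (@col_mul _) x m c
  = walks (balanced n k) (@col_mul _) x m.+1 [tuple o | i < k * n].
Proof.
pose h (c : (k * n).-tuple 'I_n) := col_mul [tuple o | i < k * n] c.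
have h_inj : injective h.
  move=> c c' /(congr1 (fun t => tnth t _)) e; apply: eq_from_tnth => i.
  by apply: (@quasigroup_injl o); have := e i; rewrite !tnth_mktuple.
rewrite [LHS](reindex_inj h_inj) /=; apply: eq_bigl => c.
have hcnt a : count_mem (op o a) (h c) = count_mem a c.
  rewrite !count_tuple; apply: eq_card => i; rewrite !inE !tnth_mktuple.
  exact: inj_eq (@quasigroup_injl o) _ _.
apply/balancedP/balancedP => cB a; first by rewrite -hcnt.
by have [[b [<- _]] _] := opP o a; rewrite hcnt.
Qed.

End Columns.

Lemma ltn_count (T : eqType) (a1 a2 : pred T) (s : seq T) x :
    {in s, forall y, a1 y -> a2 y} -> x \in s -> a2 x -> ~~ a1 x ->
  (count a1 s < count a2 s)%N.
Proof.
move=> sub xs a2x a1x; rewrite -[X in (_ < X)%N]size_filter -(count_predC a1).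
have -> : count a1 [seq y <- s | a2 y] = count a1 s.
  rewrite count_filter; apply: eq_in_count => y ys /=.
  by apply/andP/idP => [[]|a1y] //; split=> //; apply: sub.
rewrite -[ltnLHS]addn0 ltn_add2l -has_count; apply/hasP; exists x => //.
by rewrite mem_filter a2x.
Qed.

(** * Ordered multiplexes as walks of columns *)

Section Multiplexes.
Local Open Scope nat_scope.
Variables (n k d : nat) (op : 'I_n -> 'I_n -> 'I_n).
Hypothesis opP : quasigroup op.
Implicit Types (u : (k * n).-tuple (array_index n d)) (K : {mset array_index n d}%mset).

Lemma count_hyperplane u j a :
  count [pred x | x \in hyperplane j a] (seq_mset u)
    = count_mem a (tnth (transpose u) j).
Proof.
rewrite (seq.permP (perm_eq_seq_mset u)) !count_tuple; apply: eq_card => i.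
by rewrite !inE tnth_transpose.
Qed.

(** The hyperplane conditions at coordinate [j] say that column [j] is balanced; the support
    condition concerns the rows. *)
Lemma is_multiplex_seq_mset u :
  is_multiplex op k (seq_mset u) <->
  all [in balanced n k] (transpose u) && all (@mds_code n op d) u.
Proof.
split=> [[_ uM uB]|/andP[/all_tnthP uB /allP uM]].
  apply/andP; split; last first.
    by apply/allP => x xu; apply: uM; rewrite (perm_mem (perm_eq_seq_mset u)).
  by apply/all_tnthP => j; apply/balancedP => a; rewrite -count_hyperplane.
split; first by rewrite (perm_size (perm_eq_seq_mset u)) size_tuple.
  by move=> x; rewrite (perm_mem (perm_eq_seq_mset u)) => /uM.
by move=> j a; rewrite count_hyperplane; apply/balancedP.
Qed.

(** Entry [i] of the folded columns is the iterated product of row [i]; [o] is the ordinal standing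
    for the element 1. *)
Lemma all_mds_code (o : 'I_n) u : o = 0 :> nat ->
  all (@mds_code n op d) u =
  (foldl (@col_mul n op _) (thead (transpose u)) (behead (transpose u))
     == [tuple o | i < k * n]).
Proof.
move=> o0.
move: (transpose u) (@tnth_transpose _ _ _ u) => t tE.
have iter_col i : tnth (foldl (@col_mul n op _) (thead t) (behead t)) i
    = iterated op (tnth u i).
  rewrite tnth_foldl_col_mul /iterated; congr foldl; first exact: tE.
  apply: (@eq_from_nth _ o) => [|j]; first by rewrite size_map !size_behead !size_tuple.
  rewrite size_map size_behead size_tuple /= => jd.
  rewrite (nth_map [tuple o | i < k * n]) ?size_behead ?size_tuple // !nth_behead.
  have jd' : j.+1 < d.+1 by [].
  by rewrite -[j.+1]/(val (Ordinal jd')) -!tnth_nth tE.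
apply/all_tnthP/eqP => [um|e i].
  apply: eq_from_tnth => i; rewrite iter_col tnth_mktuple; apply: ord_inj.
  by rewrite o0; apply/eqP/um.
by rewrite /mds_code -iter_col e tnth_mktuple o0.
Qed.

(** The first column is a starting state and the other [d] are steps; summing over balanced starts
    adds one step from the constant column. *)
Lemma card_ordered_multiplexes (o : 'I_n) : o = 0 :> nat ->
  #|[set u : (k * n).-tuple (array_index n d)
      | `[< is_multiplex op k (seq_mset u) >]]%SET|
   = walks (balanced n k) (@col_mul n op _) [tuple o | i < k * n] d.+1
           [tuple o | i < k * n].
Proof.
move=> o0; set z := [tuple o | _ < _]; rewrite -(balanced_walks opP).
pose P (s : d.+1.-tuple ((k * n).-tuple 'I_n)) :=
  all [in balanced n k] s && (foldl (@col_mul n op _) (thead s) (behead s) == z).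
transitivity #|[set s | P s]%SET|.
  rewrite -[RHS](@on_card_preimset _ _ (@transpose _ _ _)); last first.
    by apply: onW_bij; exists (@transpose _ _ _); apply: transposeK.
  apply: eq_card => u; rewrite !inE /P /z -all_mds_code //.
  by apply/asboolP/idP; apply is_multiplex_seq_mset.
rewrite card_cons_tuple [RHS]big_mkcond; apply: eq_bigr => c _.
rewrite /P -card_walks /=; move: (balanced n k) => Bal; case: ifP => cB.
  by apply: eq_card => t; rewrite !inE.
by apply: eq_card0 => t; rewrite !inE.
Qed.

(** A column separating two rows rules out repetitions, one joining them rules out a disconnection,
    and a separating one together with its swapped copy rules out a division. *)
Lemma spanning_conn_indiv u : (n = 1 <-> k = 1) -> 0 < n -> 0 < k ->
  is_multiplex op k (seq_mset u) ->
  (forall c, c \in balanced n k -> c \in tval (transpose u)) ->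
  conn_indiv_plexes op k (seq_mset u).
Proof.
move=> nk n0 k0 uM span.
have memu := perm_mem (perm_eq_seq_mset u).
(* For [n = k = 1] there is a single row; otherwise [nk] makes both numbers exceed 1. *)
have two (i i' : 'I_(k * n)) : i != i' -> 1 < n /\ 1 < k.
  move=> ii'; have [n1|n1] := eqVneq n 1; last first.
    by split; rewrite ltn_neqAle eq_sym ?n0 ?k0 andbT //; apply: contraNneq n1 => /nk->.
  exfalso; have k1 := nk.1 n1; move: ii'; rewrite -(inj_eq val_inj) /=.
  by case: i i' => [i ilt] [i' ilt'] /=; move: ilt ilt'; rewrite n1 k1; case: i i' => [|?] [|?].
have uu : uniq u.
  apply/tuple_uniqP => i i' ii'; apply/eqP; apply: contraT => /[dup]/two[n1 _].
  move=> /(balanced_separates n1 k0)[c /span/tnthP[j ->]].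
  by rewrite !tnth_transpose ii' eqxx.
have mult x : x \in seq_mset u -> seq_mset u x = 1.
  by rewrite memu mset_seqE count_uniq_mem // => ->.
have disj (K1 K2 : {mset array_index n d}%mset) x :
    seq_mset u = (K1 `+` K2)%mset -> x \in K1 -> x \in K2 -> False.
  move=> e x1 x2; have := mult x; rewrite e in_msetD x1 => /(_ isT).
  by move: x1 x2; rewrite !in_mset !msetE2; lia.
have pick_row (K : {mset array_index n d}%mset) m : 0 < m -> size K = m ->
    (forall x, x \in K -> x \in seq_mset u) -> exists i, tnth u i \in K.
  move=> m0 sK Ku; case E: (K : seq _) => [|y s]; first by rewrite -sK E in m0.
  have yK : y \in (K : seq _) by rewrite E mem_head.
  by have := Ku y yK; rewrite memu => /tnthP[i yi]; exists i; rewrite -yi.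
split; first by [].
  move=> [n1 [n2 [n10 n20 n12 [S1 [S2 [Spart [K1 [K2 [[s1 K1S _] [s2 K2S _] e]]]]]]]]].
  have [|x xK|i i1] := pick_row K1 (k * n1) _ s1; first by rewrite muln_gt0 k0.
    by rewrite e in_msetD xK.
  have [|x xK|i' i2] := pick_row K2 (k * n2) _ s2; first by rewrite muln_gt0 k0.
    by rewrite e in_msetD xK orbT.
  have k1 : 1 < k.
    by rewrite ltn_neqAle k0 andbT eq_sym; apply/eqP => /nk; lia.
  (* Row [i] of [K1] and row [i'] of [K2] share a symbol in this column, although [S1 j] and [S2 j]
     are disjoint. *)
  have [c /span/tnthP[j ->]] := balanced_joins i i' k1.
  rewrite !tnth_transpose => eij; have [_ /pred0P/(_ (tnth (tnth u i) j)) /=] := Spart j.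
  by rewrite (K1S _ i1) eij (K2S _ i2).
move=> [k1 [k2 [k10 k20 k12 [K1 [K2 [[s1 _ B1] [s2 _ _] e]]]]]].
have [|x xK|i i1] := pick_row K1 (k1 * n) _ s1; first by rewrite muln_gt0 k10.
  by rewrite e in_msetD xK.
have [|x xK|i' i2] := pick_row K2 (k2 * n) _ s2; first by rewrite muln_gt0 k20.
  by rewrite e in_msetD xK orbT.
have ii' : i != i' by apply/eqP => ii'; rewrite -ii' in i2; exact: disj e i1 i2.
have [n1 _] := two _ _ ii'.
have [c cB cii'] := balanced_separates n1 k0 ii'.
have /tnthP[j cj] := span _ cB.
(* Exchanging entries [i] and [i'] keeps [c] balanced, so this column occurs too; yet [K1] contains
   row [i] and not row [i']. *)
have /tnthP[j' cj'] := span _ (balanced_tperm i i' cB).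
(* Every element of [K1] but row [i] meets symbol [c i] in both columns or in none. *)
have := B1 j (tnth c i); rewrite -(B1 j' (tnth c i)).
apply/eqP; rewrite gtn_eqF //.
have sub : {in (K1 : seq _), forall x,
    x \in hyperplane j' (tnth c i) -> x \in hyperplane j (tnth c i)}.
  move=> x x1; have : x \in seq_mset u by rewrite e in_msetD; apply/orP; left.
  rewrite memu => /tnthP[l xl]; rewrite !inE xl -!(tnth_transpose u) -cj -cj' tnth_mktuple.
  case: tpermP => [li|li|//]; first by rewrite li.
  by exfalso; apply: disj e x1 _; rewrite xl li.
apply: (ltn_count sub i1); first by rewrite !inE -(tnth_transpose u) -cj.
by rewrite inE -(tnth_transpose u) -cj' tnth_mktuple tpermL eq_sym.
Qed.

End Multiplexes.

(** * Orderings of multisets *)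

Section OrderedMultisets.
Local Open Scope nat_scope.
Variables (T : finType) (r : nat).
Implicit Types (K : {mset T}%mset) (F : {fset {mset T}%mset}%fset).

Lemma card_orderings_gt0 K : size K = r ->
  0 < #|[set u : r.-tuple T | seq_mset u == K]%SET|.
Proof.
move=> /eqP sK; apply/card_gt0P; exists (Tuple sK); rewrite inE /=.
by rewrite seq_mset_id.
Qed.

Lemma card_orderings K : size K = r -> uniq K ->
  #|[set u : r.-tuple T | seq_mset u == K]%SET| = r`!.
Proof.
move=> sK uK; rewrite -[in RHS]sK -(size_permutations uK) cardE.
rewrite -(size_map val); apply: perm_size; apply: uniq_perm.
- by rewrite map_inj_uniq ?enum_uniq //; apply: val_inj.
- exact: permutations_uniq.
move=> s; rewrite mem_permutations; apply/mapP/idP => [[u]|sK'].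
  by rewrite mem_enum inE => /eqP<- ->; rewrite perm_sym perm_eq_seq_mset.
have ss : size s == r by rewrite (perm_size sK') sK.
exists (Tuple ss) => //; rewrite mem_enum inE /= -[X in _ == X]seq_mset_id.
exact/eqP/eq_seq_msetP.
Qed.

Lemma card_seq_mset_preim F :
  #|[set u : r.-tuple T | seq_mset u \in F]%SET|
    = \sum_(K <- F) #|[set u : r.-tuple T | seq_mset u == K]%SET|.
Proof.
rewrite -sum1_card.
transitivity (\sum_(u : r.-tuple T) \sum_(K <- F) (seq_mset u == K)).
  rewrite big_mkcond; apply: eq_bigr => u _; rewrite inE -/(nat_of_bool _) -(count_uniq_mem _ (fset_uniq F)) -sum1_count.
  rewrite [LHS]big_mkcond; apply: eq_bigr => K _ /=.
  by rewrite eq_sym; case: (_ == _).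
rewrite exchange_big; apply: eq_bigr => K _.
by rewrite -sum1_card [RHS]big_mkcond; apply: eq_bigr => u _; rewrite inE; case: eqP.
Qed.

End OrderedMultisets.

(** * Bounding the exceptional multiplexes *)

Section CountingPlexes.
Local Open Scope nat_scope.
Variables (n k : nat) (op : 'I_n -> 'I_n -> 'I_n).
Hypotheses (n_gt0 : 0 < n) (opP : quasigroup op) (k_gt0 : 0 < k).
Hypothesis nk1 : n = 1 <-> k = 1.

Let B := balanced n k.

Definition ordered_exceptions d :=
  [set u : (k * n).-tuple (array_index n d) |
    `[< is_multiplex op k (seq_mset u) /\ ~ conn_indiv_plexes op k (seq_mset u) >]]%SET.

(** An exception misses some balanced column [c], so its [d.+1] columns lie among the [#|B|.-1]
    others; take a union bound over [c]. *)
Lemma card_ordered_exceptions d :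
  #|ordered_exceptions d| <= #|B| * #|B|.-1 ^ d.+1.
Proof.
pose miss c := [set u : (k * n).-tuple (array_index n d) |
  all [in (B :\ c)%SET] (transpose u)]%SET.
have sub : ordered_exceptions d \subset (\bigcup_(c in B) miss c)%SET.
  apply/fintype.subsetP => u; rewrite inE => /asboolP[uM nu].
  apply/bigcupP; apply: contrapT => none; apply: nu.
  apply: spanning_conn_indiv => // c cB; apply: contrapT => cu; apply: none.
  exists c => //; rewrite inE; apply/allP => c' c'u.
  have /is_multiplex_seq_mset/andP[/allP uB _] := uM.
  rewrite in_setD1 uB // andbT; apply/eqP => c'c.
  by apply: cu; rewrite -c'c.
apply: leq_trans (subset_leq_card sub) _.
have le_miss : #|(\bigcup_(c in B) miss c)%SET| <= \sum_(c in B) #|miss c|.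
  elim/big_rec2: _ => [|c m A _ le]; first by rewrite cards0.
  by apply: leq_trans (leq_card_setU _ _) _; rewrite leq_add2l.
apply: leq_trans le_miss _.
rewrite -sum_nat_const; apply: leq_sum => c cB.
have -> : #|B|.-1 = #|(B :\ c)%SET| by rewrite (cardsD1 c B) cB.
rewrite -card_all_tuple -(card_imset _ (can_inj (@transposeK _ _ _))).
apply/subset_leq_card/fintype.subsetP => _ /imsetP[u + ->].
by rewrite !inE.
Qed.

Lemma conn_indiv_plexes_uniq d (K : {mset array_index n d}%mset) :
  conn_indiv_plexes op k K -> uniq K.
Proof.
case=> -[_ K1] _ _; apply: count_mem_uniq => x; rewrite count_mem_mset.
by case: (boolP (x \in (K : seq _))) => [/K1|/mset_eq0P].
Qed.

Lemma in_multiplexes d (K : {mset array_index n d}%mset) :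
  K \in fset_set (multiplexes op k (d := d)) = `[< is_multiplex op k K >].
Proof. by rewrite in_fset_set ?inE //; exact: finite_multiplexes. Qed.

Lemma in_conn_indiv_plexes d (K : {mset array_index n d}%mset) :
  K \in fset_set (conn_indiv_plexes op k (d := d)) = `[< conn_indiv_plexes op k K >].
Proof. by rewrite in_fset_set ?inE //; exact: finite_conn_indiv_plexes. Qed.

Lemma card_ordered_plexes d :
  #|[set u : (k * n).-tuple (array_index n d) |
      `[< conn_indiv_plexes op k (seq_mset u) >]]%SET|
  = num_conn_indiv_plexes op k d * (k * n)`!.
Proof.
transitivity #|[set u : (k * n).-tuple (array_index n d)
    | seq_mset u \in fset_set (conn_indiv_plexes op k (d := d))]%SET|.
  by apply: eq_card => u; rewrite !inE in_conn_indiv_plexes.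
rewrite card_seq_mset_preim big_seq (eq_bigr (fun=> (k * n)`!)) => [|K].
  by rewrite -big_seq big_const_seq count_predT iter_addn_0 mulnC.
rewrite in_conn_indiv_plexes => /asboolP KP; apply: card_orderings.
  by case: KP => -[[]].
exact: conn_indiv_plexes_uniq KP.
Qed.

Lemma card_ordered_split d :
  #|[set u : (k * n).-tuple (array_index n d)
      | `[< is_multiplex op k (seq_mset u) >]]%SET|
  = num_conn_indiv_plexes op k d * (k * n)`! + #|ordered_exceptions d|.
Proof.
rewrite -card_ordered_plexes -cardsUI [X in _ + X](_ : _ = 0) ?addn0; last first.
  apply: eq_card0 => u; rewrite !inE; apply/negbTE/negP => /andP[/asboolP pu].
  by move=> /asboolP[].
apply: eq_card => u; rewrite !inE; apply/asboolP/orP => [uM|].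
  have [pu|pu] := pselect (conn_indiv_plexes op k (seq_mset u)); first by left; apply/asboolP.
  by right; apply/asboolP.
by move=> [/asboolP[[]]|/asboolP[]].
Qed.

(** A multiplex with repeated elements has fewer than $(kn)!$ orderings but at least one, which
    suffices for the upper bound. *)
Lemma num_conn_indiv_plexes_le_Per d :
  num_conn_indiv_plexes op k d <= Per op k d <=
  num_conn_indiv_plexes op k d + #|ordered_exceptions d|.
Proof.
set F := fset_set (multiplexes op k (d := d)).
set G := fset_set (conn_indiv_plexes op k (d := d)).
have GF : (G `<=` F)%fset.
  apply/fsubsetP => K; rewrite in_multiplexes in_conn_indiv_plexes.
  by move=> /asboolP[[? _] _ _]; apply/asboolP.
rewrite /num_conn_indiv_plexes /Per -/F -/G fsubset_leq_card //=.
rewrite -(cardfsID G F) (_ : (F `&` G)%fset = G) ?leq_add2l; last exact/fsetIidPr.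
have -> : #|ordered_exceptions d| = #|[set u : (k * n).-tuple (array_index n d)
    | seq_mset u \in (F `\` G)%fset]%SET|.
  apply: eq_card => u; rewrite !inE in_multiplexes in_conn_indiv_plexes.
  by rewrite andbC -asbool_neg asbool_and.
rewrite card_seq_mset_preim -sum1_size big_seq [leqRHS]big_seq leq_sum // => K.
rewrite in_fsetD in_multiplexes => /andP[_ /asboolP[sK _ _]].
exact: card_orderings_gt0.
Qed.

End CountingPlexes.

(** * The two limits *)

Theorem theorem3 (R : realType) (n : nat) (op : 'I_n -> 'I_n -> 'I_n) (k : nat)
  (hn : (1 <= n)%N) (hop : quasigroup op) (hk : (1 <= k)%N)
  (hnk : n = 1%N <-> k = 1%N) :
  ((fun d : nat => (num_conn_indiv_plexes op k d)%:R / (Per op k d)%:R : R)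
     @ within [set d : nat | (0 < Per op k d)%N] \oo --> (1 : R)) /\
  (exists c : R, 0 < c /\
    ((fun d : nat => (num_conn_indiv_plexes op k d)%:R
                     / ((k * n)`!%:R / (k`! ^ n)%:R) ^+ (d - 1) : R)
       @ within [set d : nat | (0 < Per op k d)%N] \oo --> c)).
Proof.
pose B := balanced n k; pose z := [tuple Ordinal hn | i < (k * n)%N].
have f_inj c : c \in B -> injective (fun x => col_mul op x c).
  by move=> _; exact: col_mul_inj.
have B_gt0 : (0 < #|B|)%N := card_balanced_gt0 n k.
pose M : R := #|B|%:R; have M_gt0 : 0 < M by rewrite ltr0n.
have M_neq0 : M != 0 by rewrite gt_eqF.
(* The base of the power is the number of balanced columns. *)
have ME : (k * n)`!%:R / (k`! ^ n)%:R = M :> R.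
  rewrite -card_balanced natrM mulfK // pnatr_eq0 -lt0n expn_gt0 fact_gt0 //.
pose r : R := (k * n)`!%:R; have r_gt0 : 0 < r by rewrite ltr0n fact_gt0.
have r_neq0 : r != 0 by rewrite gt_eqF.
have [m0 stable] := card_sources_stable f_inj B_gt0 z.
have [s s_gt0 s_lim] := walk_density_cvg R f_inj B_gt0 stable.
pose dens d : R := walk_density B (@col_mul n op _) R z d.+1 z.
pose exc d : R := #|ordered_exceptions k op d|%:R / M ^+ d.+1.
set F := within _ _.
have num_r d : (num_conn_indiv_plexes op k d)%:R * r = (dens d - exc d) * M ^+ d.+1.
  rewrite mulrBl !divfK ?expf_neq0 // -natrM; apply/eqP; rewrite -subr_eq opprK -natrD.
  by rewrite -card_ordered_split (card_ordered_multiplexes k d hop (erefl : Ordinal hn = 0%N :> nat)).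
have dens_cvg : dens @ F --> s.
  apply/cvgrPdist_lt => e e_gt0; have [N Nlim] := s_lim e e_gt0.
  rewrite near_withinE; exists N => // d /= Nd Per_gt0.
  rewrite distrC; apply: Nlim; first exact: leqW.
  (* Positivity of [Per] says that [z] returns to itself in [d.+1] steps, which is where the density
     is controlled. *)
  rewrite inE -(card_ordered_multiplexes k d hop (erefl : Ordinal hn = 0%N :> nat)).
  rewrite card_ordered_split.
  have /andP[_ /(leq_trans Per_gt0)] := num_conn_indiv_plexes_le_Per k op d.
  by have := fact_gt0 (k * n); nia.
have exc_cvg : exc @ F --> (0 : R).
  apply: cvg_trans (cvg_app _ (cvg_within _)) _.
  (* The exceptional share is at most [M * q ^+ d.+1], and [q < 1]. *)
  pose q : R := #|B|.-1%:R / M.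
  have q_lt1 : `|q| < 1.
    by rewrite ger0_norm ?divr_ge0 ?ler0n // ltr_pdivrMr // mul1r ltr_nat prednK.
  apply: squeeze_cvgr (cvg_cst 0) (cvg_geometric (M * q) q_lt1).
  apply: nearW => d; rewrite divr_ge0 ?ler0n ?exprn_ge0 ?(ltW M_gt0) //=.
  rewrite -mulrA -exprS expr_div_n mulrA ler_wpM2r ?invr_ge0 ?exprn_ge0 ?(ltW M_gt0) //.
  by rewrite -natrX -natrM ler_nat card_ordered_exceptions.
(* [M ^+ 2] compares [M ^+ d.+1] with the power [d - 1], and [r] is the number of orderings of each
   plex. *)
pose c := s * (M ^+ 2 / r).
(* Since [d - 1] truncates, [d = 0] is left out; the limit only concerns large [d]. *)
have pow d : (0 < d)%N -> M ^+ d.+1 = M ^+ 2 * M ^+ (d - 1).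
  by move=> d_gt0; rewrite -exprD addnBA // add2n subSS subn0.
have d_gt0 : \forall d \near F, (0 < d)%N.
  by apply: cvg_within; exists 1%N.
have num_cvg : (fun d => (num_conn_indiv_plexes op k d)%:R / M ^+ (d - 1) : R) @ F --> c.
  have : (fun d => (dens d - exc d) * (M ^+ 2 / r)) @ F --> c.
    by rewrite /c -[s]subr0; apply: cvgMl; apply: cvgB.
  apply: cvg_trans; apply: near_eq_cvg; apply: filterS d_gt0 => d d0.
  apply: (mulIf r_neq0); rewrite [RHS]mulrAC num_r (pow d) //.
  by field; rewrite r_neq0 expf_neq0.
(* [Per] is squeezed between the number of plexes and that number plus the exceptions, whose share
   vanishes. *)
have Per_cvg : (fun d => (Per op k d)%:R / M ^+ (d - 1) : R) @ F --> c.
  have up : (fun d => (num_conn_indiv_plexes op k d)%:R / M ^+ (d - 1) + exc d * M ^+ 2) @ F --> c.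
    by rewrite -[c]addr0 -[X in _ + X](mul0r (M ^+ 2)); apply: cvgD => //; apply: cvgMl.
  apply: squeeze_cvgr num_cvg up; apply: filterS d_gt0 => d d0.
  have /andP[lo hi] := num_conn_indiv_plexes_le_Per k op d.
  rewrite ler_pM2r ?invr_gt0 ?exprn_gt0 // ler_nat lo /=.
  have -> : exc d * M ^+ 2 = #|ordered_exceptions k op d|%:R / M ^+ (d - 1).
    by rewrite /exc (pow d) //; field; rewrite M_neq0 expf_neq0.
  by rewrite -mulrDl ler_pM2r ?invr_gt0 ?exprn_gt0 // -natrD ler_nat.
have c_gt0 : 0 < c by rewrite mulr_gt0 // divr_gt0 // exprn_gt0.
split; last by exists c; rewrite ME.
have : (fun d => ((num_conn_indiv_plexes op k d)%:R / M ^+ (d - 1))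
                / ((Per op k d)%:R / M ^+ (d - 1)) : R) @ F --> c / c.
  by apply: cvgM => //; apply: cvgV => //; rewrite gt_eqF.
rewrite divff ?gt_eqF //; apply: cvg_trans; apply: near_eq_cvg; apply: nearW => d /=.
by rewrite invf_div mulrA divfK ?expf_neq0.
Qed.
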